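(* Let $G$ be a totally disconnected, locally compact group and let $A$ be a subgroup of $G$ (not necessarily closed). Suppose that $\overline{A}$ is either cocompact or of finite covolume in $G$. Then for every compactly generated subgroup $H_1$ of $G$, there is a subgroup $H_2$ of $A$ such that $H_1 \approx_G H_2$. If $\overline{A}$ is cocompact in $G$, then $H_2$ can be chosen to be finitely generated.
   Context: All topological groups are Hausdorff. A subgroup of $G$ is compactly generated if it is generated by a compact subset. A closed subgroup $B$ of $G$ is cocompact if $G/B$ is compact, and of finite covolume if $G/B$ carries a nonzero finite $G$-invariant Radon measure. For a subgroup $H\le G$, a reduced envelope for $H$ in $G$ is an open subgroup $E$ of $G$ such that $H\le E$ and such that, for any open subgroup $E_2$ of $G$ with $|H:H\cap E_2|$ finite, $|E:E\cap E_2|$ is finite. Reduced envelopes, when they exist, are unique up to commensurability (two subgroups are commensurate if their intersection has finite index in both). If $H$ has a reduced envelope, its envelope class $E_G(H)$ is the set of open subgroups of $G$ commensurate to a reduced envelope for $H$. Subgroups $H_1,H_2\le G$ are envelope equivalent, written $H_1\approx_G H_2$, if both have reduced envelopes in $G$ and $E_G(H_1)=E_G(H_2)$. *)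

(* Defs.v *)
(* MathComp / MathComp-Analysis *)
From HB Require Import structures.
From mathcomp Require Import all_boot all_order all_algebra.
From mathcomp Require Import all_classical all_reals all_analysis.

Set Implicit Arguments.
Unset Strict Implicit.
Unset Printing Implicit Defensive.

Local Open Scope classical_set_scope.
Local Open Scope ring_scope.
Local Open Scope group_scope.

HB.mixin Record isTopologicalGroup G & Group G & Topological G := {
  mulg_continuous : continuous (fun p : G * G => p.1 * p.2);
  invg_continuous : continuous (fun x : G => x^-1)
}.

#[short(type="topologicalGroupType")]
HB.structure Definition TopologicalGroup :=
  {G of Group G & Topological G & isTopologicalGroup G}.

Section Subgroups.
Context {G : groupType}.
Implicit Types (A H K S : set G).

Definition subgroup H := group_closed [in H].

Definition generated_subgroup S : set G := smallest subgroup S.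

Definition finitely_generated H := exists2 S, finite_set S & H = generated_subgroup S.

Definition left_coset x K : set G := [set x * k | k in K].

(* [|H : K|] is finite, for [K] a subgroup of [H]. *)
Definition finite_index H K := finite_set [set left_coset h K | h in H].

Definition commensurate H K :=
  finite_index H (H `&` K) /\ finite_index K (H `&` K).

End Subgroups.

Section CosetSpace.
Local Open Scope quotient_scope.
Context {G : topologicalGroupType}.
Implicit Types B : set G.

(* Being in the same left coset of [B] is an equivalence relation for an arbitrary set  *)
(* [B], so that [coset_space] needs no proof that [B] is a subgroup; it is   *)
(* only meaningful when [B] is one.                                          *)
Definition same_left_coset B : rel G := fun x y => `[< left_coset x B = left_coset y B >].

Lemma same_left_coset_equiv B : equiv_class_of (same_left_coset B).
Proof.
split=> [x|x y|y x z]; rewrite /same_left_coset.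
- by apply/asboolP.
- by apply/asboolP/asboolP => ->.
- by move=> /asboolP -> /asboolP ->; apply/asboolP.
Qed.

Canonical same_left_coset_equivRel B := EquivRelPack (same_left_coset_equiv B).

Definition coset_space B : Type :=
  quotient_topology {eq_quot same_left_coset_equivRel B}.

HB.instance Definition _ B := Topological.on (coset_space B).
HB.instance Definition _ B := Quotient.on (coset_space B).
HB.instance Definition _ B :=
  isPointed.Build (coset_space B) (\pi_(coset_space B) 1).

(* Left translation [g . xB = gxB]; the result does not depend on the        *)
(* representative when [B] is a subgroup.                                    *)
Definition coset_act B (g : G) (u : coset_space B) : coset_space B :=
  \pi_(coset_space B) (g * repr u).

Definition cocompact B := compact [set: coset_space B].

End CosetSpace.

Section Covolume.
Local Open Scope ereal_scope.

Definition borel (T : ptopologicalType) := g_sigma_algebraType (@open T).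

Definition radon {R : realType} {T : ptopologicalType}
    (mu : {measure set (borel T) -> \bar R}) :=
  [/\ forall K : set T, compact K -> mu K < +oo,
      forall E : set (borel T), measurable E ->
        mu E = ereal_inf [set mu U | U in [set U : set T | open U /\ E `<=` U]]
    & forall U : set T, open U ->
        mu U = ereal_sup [set mu K | K in [set K : set T | compact K /\ K `<=` U]]
  ].

Definition finite_covolume (R : realType) {G : topologicalGroupType}
    (B : set G) :=
  exists mu : {measure set (borel (coset_space B)) -> \bar R},
    [/\ radon mu, mu setT != 0, mu setT < +oo
      & forall (g : G) (E : set (borel (coset_space B))), measurable E ->
          mu (coset_act g @` E) = mu E].

End Covolume.

Section Envelopes.
Context {G : topologicalGroupType}.
Implicit Types H E : set G.

Definition compactly_generated H := exists2 K, compact K & H = generated_subgroup K.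

Definition open_subgroup E := subgroup E /\ open E.

Definition reduced_envelope H E :=
  [/\ open_subgroup E, H `<=` E
    & forall E2, open_subgroup E2 ->
        finite_index H (H `&` E2) -> finite_index E (E `&` E2)].

Definition envelope_class H : set (set G) :=
  [set E | open_subgroup E /\
           exists2 E0, reduced_envelope H E0 & commensurate E E0].

Definition envelope_equivalent H1 H2 :=
  [/\ exists E, reduced_envelope H1 E, exists E, reduced_envelope H2 E
    & envelope_class H1 = envelope_class H2].

End Envelopes.

(* Main.v *)
Require Import Defs.
From mathcomp Require Import all_boot all_order all_algebra.
From mathcomp Require Import all_classical all_reals all_analysis.
From mathcomp Require Import measurable_realfun.

(* Every compactly generated H = <X> has a compactly generated reduced        *)
(* envelope. Let U be a compact open subgroup and R the intersection of the   *)
(* open subgroups normalized by H. By compactness some such subgroup N        *)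
(* satisfies N \cap U <= V R, where V is a neighbourhood of 1 so small that   *)
(* conjugation by the generators maps it into U; then D = (N \cap U) R is     *)
(* stable under conjugation by H, and it is a subgroup because R lies in its  *)
(* left stabilizer, which is open and normalized by H. Every open subgroup    *)
(* that virtually contains H contains R, hence also a finite index subgroup   *)
(* of E = <X, N \cap U> = (N \cap U) H R.                                     *)
(*   It remains to find H2 <= A with E as a reduced envelope. If the closure  *)
(* B of A is cocompact, a Schwarz-Milnor argument yields a finitely generated *)
(* H2 <= A \cap E with E = K H2 for some compact K, and this suffices. If B   *)
(* has finite covolume, H2 = A \cap E works: when A \cap E lies in n left     *)
(* cosets of an open subgroup E2, the images in G / B of the sets g (E \cap   *)
(* E2), for g in distinct left cosets of E2 in E, have the same positive      *)
(* measure and cover no point more than n times, so that there are only       *)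
(* finitely many of them.                                                     *)

Set Implicit Arguments.
Unset Strict Implicit.
Unset Printing Implicit Defensive.

Local Open Scope classical_set_scope.

(** * Products of sets and coverings by cosets *)

(** Two subgroups with a common reduced envelope are envelope equivalent
    ([common_envelope_equivalent]), so it suffices to find a reduced envelope [E] of [H1] and a
    subgroup of [A] for which [E] is reduced too. Finite index is handled as a covering by finitely
    many cosets, which is transitive ([covered_trans]) and, for open subgroups, survives left
    multiplication by a compact set ([covered_mulset_compact]). For the existence of [E]
    ([exists_reduced_envelope]), a compact open subgroup ([compact_open_subgroup], van Dantzig)
    feeds [cocompact_residual]. The envelope then lies in [W H1 R] with [W] compact, and every open
    subgroup virtually containing [H1] contains [R]. If the closure of [A] is cocompact,
    [finitely_generated_in_dense] writes [E] inside a compact set times a finitely generated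
    subgroup of [A]. If it has finite covolume, the packing bound [finite_covolume_covered] shows
    that [E] is reduced for [closure A] intersected with [E], and [covered_closure] replaces
    [closure A] by [A]. *)

Section GroupSets.
Local Open Scope group_scope.
Context {G : groupType}.
Implicit Types (A B H K S D : set G) (x y : G).

Lemma subgroupP H :
  subgroup H <->
  [/\ H 1, forall x y, H x -> H y -> H (x * y) & forall x, H x -> H x^-1].
Proof.
split=> [[]|[H1 HM HV]].
  rewrite inE => H1 HF.
  have HV x : H x -> H x^-1.
    by move=> Hx; have := HF 1 x; rewrite !inE div1g; apply.
  split=> // x y Hx Hy.
  by have := HF x y^-1; rewrite !inE invgK; apply=> //; exact: HV.
split=> [|x y]; rewrite !inE // => Hx Hy.
by apply: HM => //; exact: HV.
Qed.

Lemma subgroup1 H : subgroup H -> H 1.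
Proof. by case/subgroupP. Qed.

Lemma subgroupM H x y : subgroup H -> H x -> H y -> H (x * y).
Proof. by case/subgroupP => _ + _; apply. Qed.

Lemma subgroupV H x : subgroup H -> H x -> H x^-1.
Proof. by case/subgroupP => _ _; apply. Qed.

Lemma subgroupI H K : subgroup H -> subgroup K -> subgroup (H `&` K).
Proof.
move=> sH sK; apply/subgroupP; split=> [|x y [Hx Kx] [Hy Ky]|x [Hx Kx]];
  split; by [exact: subgroup1|exact: subgroupM|exact: subgroupV].
Qed.

Lemma subgroup_bigcap (F : set (set G)) :
  F `<=` subgroup -> subgroup (\bigcap_(H in F) H).
Proof.
move=> sF; apply/subgroupP; split=> [H FH|x y Hx Hy H FH|x Hx H FH].
- by apply: subgroup1; exact: sF.
- by apply: subgroupM (sF _ FH) _ _; [exact: Hx|exact: Hy].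
- by apply: subgroupV (sF _ FH) _; exact: Hx.
Qed.

Lemma generated_subgroup_closed S : subgroup (generated_subgroup S).
Proof. by apply: subgroup_bigcap => H []. Qed.

Lemma sub_generated S : S `<=` generated_subgroup S.
Proof. exact: sub_gen_smallest. Qed.

Lemma generated_sub S H : subgroup H -> S `<=` H -> generated_subgroup S `<=` H.
Proof. exact: smallest_sub. Qed.

Lemma generated_mono A B :
  A `<=` B -> generated_subgroup A `<=` generated_subgroup B.
Proof.
move=> AB; apply: generated_sub (generated_subgroup_closed B) _.
exact: subset_trans AB (@sub_generated _).
Qed.

Definition mulset A B : set G := [set x * y | x in A & y in B].

Lemma mulsetA A B C : mulset A (mulset B C) = mulset (mulset A B) C.
Proof.
apply/seteqP; split=> z.
  move=> [a Aa [_ [b Bb [c Cc <-]] <-]]; rewrite mulgA.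
  by exists (a * b) => //; [exists a => //; exists b|exists c].
move=> [_ [a Aa [b Bb <-]] [c Cc <-]]; rewrite -mulgA.
by exists a => //; exists (b * c) => //; exists b => //; exists c.
Qed.

Lemma mulset_mono A A' B B' :
  A `<=` A' -> B `<=` B' -> mulset A B `<=` mulset A' B'.
Proof.
move=> AA' BB' z [a Aa [b Bb <-]].
by exists a; [exact: AA'|exists b => //; exact: BB'].
Qed.

Lemma mulset_id H : subgroup H -> mulset H H `<=` H.
Proof. by move=> sH _ [x Hx [y Hy <-]]; exact: subgroupM. Qed.

Lemma left_stabilizer_subgroup S :
  subgroup [set g | forall d, S d -> S (g * d) /\ S (g^-1 * d)].
Proof.
apply/subgroupP; split=> [d|x y Hx Hy d Sd|x Hx d /Hx []].
- by rewrite invg1 mul1g.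
- rewrite invgM -!mulgA; split.
    by have [/Hx[]] := Hy _ Sd.
  by have [_ /Hy[]] := Hx _ Sd.
- by rewrite invgK.
Qed.

Lemma conj_stabilizer_subgroup S :
  subgroup [set g | forall d, S d -> S (d ^ g) /\ S (d ^ g^-1)].
Proof.
apply/subgroupP; split=> [d|x y Hx Hy d Sd|x Hx d /Hx []].
- by rewrite invg1 !conjg1.
- rewrite invgM !conjgM; split.
    by have [/Hy[]] := Hx _ Sd.
  by have [_ /Hx[]] := Hy _ Sd.
- by rewrite invgK.
Qed.

(** The representatives need not lie in [S], nor [K] in [S], so coverings can be composed and
    enlarged freely. *)
Definition covered_by_cosets S K := exists2 D, finite_set D & S `<=` mulset D K.

Lemma covered_sub S S' K :
  S `<=` S' -> covered_by_cosets S' K -> covered_by_cosets S K.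
Proof. by move=> SS' [D fD S'D]; exists D => //; exact: subset_trans S'D. Qed.

Lemma sub_covered S K : S `<=` K -> covered_by_cosets S K.
Proof.
move=> SK; exists [set 1]; first exact: finite_set1.
by move=> s /SK Ks; exists 1 => //; exists s; rewrite ?mul1g.
Qed.

Lemma covered_trans S K L :
  covered_by_cosets S K -> covered_by_cosets K L -> covered_by_cosets S L.
Proof.
move=> [D fD SD] [D' fD' KD']; exists (mulset D D'); first exact: finite_image2.
by rewrite -mulsetA; apply: subset_trans SD _; exact: mulset_mono.
Qed.

Lemma left_coset_eq K x y :
  subgroup K -> K (x^-1 * y) -> left_coset x K = left_coset y K.
Proof.
move=> sK Kxy; apply/seteqP; split=> _ [k Kk <-].
  exists ((x^-1 * y)^-1 * k); first by apply: subgroupM => //; exact: subgroupV.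
  by rewrite invgM invgK -mulgA mulVKg.
exists (x^-1 * y * k); first exact: subgroupM.
by rewrite -mulgA mulVKg.
Qed.

Lemma finite_indexP H K : subgroup H -> subgroup K ->
  finite_index H (H `&` K) <-> covered_by_cosets H K.
Proof.
move=> sH sK; split=> [fHK|[D fD HD]].
  exists ((xget 1) @` [set left_coset h (H `&` K) | h in H]).
    exact: finite_image.
  move=> h Hh; have /(xgetPex 1) : exists x, left_coset h (H `&` K) x.
    exists h, 1; rewrite ?mulg1//.
    by split; exact: subgroup1.
  set x := xget _ _ => -[k [Hk Kk] hk].
  exists x; first by exists (left_coset h (H `&` K)) => //; exists h.
  exists k^-1; first exact: subgroupV.
  by rewrite -hk mulgK.
(* Each [d] is replaced by an element of [H] in the same coset of [K]; the default 1 serves the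
   cosets that miss [H]. *)
pose f d := left_coset (xget 1 (H `&` left_coset d K)) (H `&` K).
apply: (@sub_finite_set _ _ (f @` D)); last exact: finite_image.
move=> _ [h Hh <-]; have [d Dd [k Kk dkh]] := HD _ Hh.
exists d => //; rewrite /f.
have /(xgetPex 1) : exists x, (H `&` left_coset d K) x.
  by exists h; split=> //; exists k.
set x := xget _ _ => -[Hx [k' Kk' dk'x]].
apply: left_coset_eq; first exact: subgroupI.
split; first by apply: subgroupM => //; exact: subgroupV.
rewrite -dk'x -dkh invgM -mulgA mulKg.
by apply: subgroupM => //; exact: subgroupV.
Qed.

End GroupSets.

(** * Compactness in topological groups *)

(** Compactness in directed form: a finite subcover of a directed cover is absorbed by a single
    member. *)
Lemma compact_directed_cover (T : topologicalType) (K : set T)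
    (F : set (set T)) :
  compact K -> F !=set0 -> F `<=` open ->
  (forall A B, F A -> F B -> exists2 C, F C & A `|` B `<=` C) ->
  K `<=` \bigcup_(A in F) A -> exists2 A, F A & K `<=` A.
Proof.
move=> /compact_near_coveringP cK [A0 FA0] oF dF KF.
(* This filter means eventually along the directed family: near-covering compactness then gives one
   [A] that works for all points of [K]. *)
pose F' : set_system (set T) := filter_from F (fun A => [set B | A `<=` B]).
have FF' : Filter F'.
  apply: filter_from_filter; first by exists A0.
  move=> A B FA FB; have [C FC ABC] := dF _ _ FA FB.
  exists C => // D CD; split; apply: subset_trans CD => x ?; apply: ABC.
    by left.
  by right.
have [|A FA /(_ A)] := cK _ F' (fun A x => A x).
  move=> x /KF[A FA Ax]; exists (A, [set B | A `<=` B]) => /=.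
    by split; [apply: open_nbhs_nbhs; split=> //; exact: oF|exists A].
  by move=> [y B] [/= Ay]; apply.
by move=> /(_ (@subset_refl _ _)) KA; exists A.
Qed.

Lemma open_preimage (T T' : topologicalType) (f : T -> T') (W : set T') :
  continuous f -> open W -> open (f @^-1` W).
Proof. by move=> /continuousP cf; exact: cf. Qed.

Lemma compact_tube (T T' T'' : topologicalType) (f : T' -> T -> T'') (K : set T)
    (U : set T'') (y : T') :
  compact K -> open U -> continuous (fun p : T' * T => f p.1 p.2) ->
  (forall x, K x -> U (f y x)) ->
  exists V, [/\ open V, V y & forall v x, V v -> K x -> U (f v x)].
Proof.
move=> /compact_near_coveringP cK oU cf Kf.
suff : nbhs y (fun v => K `<=` (fun x => U (f v x))).
  rewrite nbhsE => -[V [oV Vy] VK]; exists V; split=> // v x Vv Kx.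
  exact: VK Vv _ Kx.
apply: cK => x Kx.
have cs : continuous (fun p : T * T' => f p.2 p.1).
  move=> p; apply: (@continuous_comp _ _ _ (fun p : T * T' => (p.2, p.1))
    (fun p : T' * T => f p.1 p.2)).
    by apply: cvg_pair; [exact: cvg_snd|exact: cvg_fst].
  exact: cf.
have : nbhs (x, y) ((fun p : T * T' => f p.2 p.1) @^-1` U).
  by apply: open_nbhs_nbhs; split; [exact: open_preimage|exact: Kf].
by [].
Qed.

Section TopologicalGroups.
Local Open Scope group_scope.
Context {G : topologicalGroupType}.
Implicit Types (A B C D E F H K N S U V W X Y : set G) (g h x y : G).

Lemma continuous_mulg2 (T : topologicalType) (f g : T -> G) :
  continuous f -> continuous g -> continuous (fun t => f t * g t).
Proof.
move=> cf cg t; apply: cvg_trans (@mulg_continuous G (f t, g t)).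
exact: cvg_app (cvg_pair (cf t) (cg t)).
Qed.

Lemma continuous_invg2 (T : topologicalType) (f : T -> G) :
  continuous f -> continuous (fun t => (f t)^-1).
Proof. by move=> cf t; apply: cvg_comp (cf t) _; exact: invg_continuous. Qed.

Lemma continuous_lmul g : continuous (fun x : G => g * x).
Proof. by apply: continuous_mulg2 => x; [exact: cvg_cst|exact: cvg_id]. Qed.

Lemma continuous_rmul g : continuous (fun x : G => x * g).
Proof. by apply: continuous_mulg2 => x; [exact: cvg_id|exact: cvg_cst]. Qed.

Lemma mulset_open_l A B : open A -> open (mulset A B).
Proof.
move=> oA.
have -> : mulset A B = \bigcup_(b in B) ((fun x => x * b^-1) @^-1` A).
  apply/seteqP; split=> [_ [a Aa [b Bb <-]]|x [b Bb /= Axb]].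
    by exists b => //=; rewrite mulgK.
  by exists (x * b^-1) => //; exists b => //; rewrite mulgVK.
apply: bigcup_open => b _.
by apply: open_preimage => //; exact: continuous_rmul.
Qed.

Lemma mulset_open_r A B : open B -> open (mulset A B).
Proof.
move=> oB.
have -> : mulset A B = \bigcup_(a in A) ((fun x => a^-1 * x) @^-1` B).
  apply/seteqP; split=> [_ [a Aa [b Bb <-]]|x [a Aa /= Bax]].
    by exists a => //=; rewrite mulKg.
  by exists a => //; exists (a^-1 * x) => //; rewrite mulVKg.
apply: bigcup_open => a _.
by apply: open_preimage => //; exact: continuous_lmul.
Qed.

Lemma compact_mulset A B : compact A -> compact B -> compact (mulset A B).
Proof.
move=> cA cB.
have -> : mulset A B = (fun p : G * G => p.1 * p.2) @` (A `*` B).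
  apply/seteqP; split=> [_ [a Aa [b Bb <-]]|_ [[a b] [/= Aa Bb] <-]].
    by exists (a, b).
  by exists a => //; exists b.
apply: continuous_compact; last exact: compact_setX.
exact/continuous_subspaceT/mulg_continuous.
Qed.

Lemma compact_invset A : compact A -> compact [set x^-1 | x in A].
Proof.
move=> cA; apply: continuous_compact => //.
exact/continuous_subspaceT/invg_continuous.
Qed.

Lemma open_subgroup_superset H V : subgroup H -> open V -> V 1 -> V `<=` H ->
  open_subgroup H.
Proof.
move=> sH oV V1 VH; split=> //.
rewrite (_ : H = mulset H V); first exact: mulset_open_r.
apply/seteqP; split=> [h Hh|].
  by exists h => //; exists 1; rewrite ?mulg1.
by apply: subset_trans (mulset_id sH); exact: mulset_mono.
Qed.

Lemma open_subgroup_closed H : open_subgroup H -> closed H.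
Proof.
move=> [sH oH] x; move=> /(_ (mulset [set x] H)) []; last first.
  move=> y [Hy [_ -> [h Hh xhy]]].
  have -> : x = y * h^-1 by rewrite -xhy mulgK.
  by apply: subgroupM => //; exact: subgroupV.
apply: open_nbhs_nbhs; split; first exact: mulset_open_r.
by exists x => //; exists 1; rewrite ?mulg1//; exact: subgroup1.
Qed.

Lemma covered_compact K H :
  compact K -> open_subgroup H -> covered_by_cosets K H.
Proof.
move=> cK [sH oH].
have [| | | |_ [D fD <-] KD] :=
    @compact_directed_cover _ K [set mulset D H | D in finite_set] cK.
- by exists (mulset set0 H), set0 => //; exact: finite_set0.
- by move=> _ [D _ <-]; exact: mulset_open_r.
- move=> _ _ [D fD <-] [D' fD' <-]; exists (mulset (D `|` D') H).
    by exists (D `|` D') => //; rewrite /= finite_setU.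
  by rewrite subUset; split; apply: mulset_mono.
- move=> x _; exists (mulset [set x] H); last first.
    by exists x => //; exists 1; rewrite ?mulg1//; exact: subgroup1.
  by exists [set x] => //; exact: finite_set1.
- by exists D.
Qed.

(** If [S] lies in [D H] with [D] finite, then [K S] lies in [(K D) H], and [K D] is compact. *)
Lemma covered_mulset_compact K S H : compact K -> open_subgroup H ->
  covered_by_cosets S H -> covered_by_cosets (mulset K S) H.
Proof.
move=> cK oH [D fD SD].
have [D' fD' KD'] : covered_by_cosets (mulset K D) H.
  apply: covered_compact => //; apply: compact_mulset => //.
  exact: finite_compact.
exists D' => //; apply: (@subset_trans _ (mulset K (mulset D H))).
  exact: mulset_mono.
rewrite mulsetA; apply: (@subset_trans _ (mulset (mulset D' H) H)).
  exact: mulset_mono.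
by rewrite -mulsetA; apply: mulset_mono => //; exact: mulset_id oH.1.
Qed.

Lemma compact_conj_nbhs K U : compact K -> open U -> U 1 ->
  exists V, [/\ open V, V 1 & forall v x, V v -> K x -> U (v ^ x)].
Proof.
move=> cK oU U1; apply: (compact_tube cK oU); last first.
  by move=> x _; rewrite conj1g.
apply: continuous_mulg2; first by apply: continuous_invg2 => p; exact: cvg_snd.
by apply: continuous_mulg2 => p; [exact: cvg_fst|exact: cvg_snd].
Qed.

Lemma compact_lmul_nbhs K U : compact K -> open U -> K `<=` U ->
  exists V, [/\ open V, V 1 & forall v x, V v -> K x -> U (v * x)].
Proof.
move=> cK oU KU; apply: (compact_tube cK oU); last first.
  by move=> x Kx; rewrite mul1g; exact: KU.
by apply: continuous_mulg2 => p; [exact: cvg_fst|exact: cvg_snd].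
Qed.

(** The subgroup is the left stabilizer of [C]: it is open because [V C] stays in [C] for some
    neighbourhood [V] of 1, and it lies in [C] because [C] contains 1. *)
Lemma compact_open_nbhs_subgroup C : compact C -> open C -> C 1 ->
  exists2 U, open_subgroup U & U `<=` C.
Proof.
move=> cC oC C1.
have [V [oV V1 VC]] := compact_lmul_nbhs cC oC (@subset_refl _ _).
exists [set g | forall d, C d -> C (g * d) /\ C (g^-1 * d)]; last first.
  by move=> g /(_ 1 C1)[]; rewrite mulg1.
apply: (@open_subgroup_superset _ (V `&` (fun x => x^-1) @^-1` V)).
- exact: left_stabilizer_subgroup.
- by apply: openI => //; apply: open_preimage => //; exact: invg_continuous.
- by split=> //=; rewrite invg1.
- by move=> g [Vg /= Vg'] d Cd; split; exact: VC.
Qed.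

Lemma compact_disjoint_nbhs A B : compact A -> closed B -> A `&` B = set0 ->
  exists O P, [/\ open O, open P, A `<=` O, B `<=` P & O `&` P = set0].
Proof.
move=> cA cB AB0.
(* If [x v w^-1] avoids [B] for all [x] in [A] and all [v], [w] in [W], then [A W] and [B W] are
   disjoint. *)
have [||x Ax|V [oV V1 VAB]] := @compact_tube G (G * G)%type G
    (fun v x => x * (v.1 * v.2^-1)) A (~` B) (1, 1) cA.
- exact: closed_openC.
- apply: continuous_mulg2 => [p|]; first exact: cvg_snd.
  apply: continuous_mulg2.
    by move=> p; apply: cvg_comp; [exact: cvg_fst|exact: cvg_fst].
  apply: continuous_invg2 => p.
  by apply: cvg_comp; [exact: cvg_fst|exact: cvg_snd].
- rewrite /= invg1 !mulg1 => Bx.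
  by have : (A `&` B) x by []; rewrite AB0.
have [[N N'] /= [nN nN'] NV] : nbhs ((1, 1) : G * G) V by exact: open_nbhs_nbhs.
pose W := N^° `&` N'^°.
have oW : open W by apply: openI; exact: open_interior.
have W1 : W 1 by [].
exists (mulset A W), (mulset B W); split; try exact: mulset_open_r.
- by move=> x Ax; exists x => //; exists 1; rewrite ?mulg1.
- by move=> x Bx; exists x => //; exists 1; rewrite ?mulg1.
- rewrite -subset0 => _ [[a Aa [v [Nv _] <-]] [b Bb [w [_ N'w] bw]]].
  apply: (VAB (v, w) a) => //=.
    by apply: NV; split=> /=; exact: interior_subset.
  by rewrite mulgA -bw mulgK.
Qed.

End TopologicalGroups.

(** * Van Dantzig's theorem: compact open subgroups *)

Section VanDantzig.
Local Open Scope group_scope.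
Context {G : topologicalGroupType}.

(* In a compact neighbourhood [K] of [1], the intersection [Q] of the         *)
(* relatively clopen sets containing [1] is connected, hence reduced to [1].  *)
Lemma compact_open_nbhs1 : hausdorff_space G -> locally_compact [set: G] ->
  totally_disconnected [set: G] ->
  exists C : set G, [/\ compact C, open C & C 1].
Proof.
move=> hG lcG tdG.
have [K nK [cK clK]] := lcG 1 I.
have {}nK : nbhs 1 K.
  by apply: filterS (nK : nbhs 1 [set x | [set: G] x -> K x]) => x; apply.
have K1 : K 1 by exact: nbhs_singleton.
pose F := [set C | [/\ C 1, closed C, C `<=` K & closed (K `\` C)]].
pose Q := \bigcap_(C in F) C.
have FK : F K by split=> //; rewrite setDv; exact: closed0.
have FI C C' : F C -> F C' -> F (C `&` C').
  move=> [C1 clC CK clKC] [C'1 clC' C'K clKC']; split=> //.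
  - exact: closedI.
  - by move=> x [/CK].
  - by rewrite setDIr; exact: closedU.
have QK : Q `<=` K by move=> x /(_ K FK).
have Q1 : Q 1 by move=> C [].
have clQ : closed Q by apply: closed_bigI => C [].
(* By compactness of [K], the downward directed family [F], whose intersection is [Q], has a member
   inside any open [W] containing [Q]. *)
have key W : open W -> Q `<=` W -> exists2 C, F C & C `<=` W.
  move=> oO QO.
  have [| | | |_ [C FC <-] KC] :=
      @compact_directed_cover _ K [set W `|` ~` C | C in F] cK.
  - by exists (W `|` ~` K), K.
  - by move=> _ [C [_ clC _ _] <-]; apply: openU => //; exact: closed_openC.
  - move=> _ _ [C FC <-] [C' FC' <-]; exists (W `|` ~` (C `&` C')).
      by exists (C `&` C') => //; exact: FI.
    by move=> x [[?|nC]|[?|nC]]; [left| right => -[] | left | right => -[]].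
  - move=> x Kx; have [Qx|] := pselect (Q x).
      by exists (W `|` ~` K); [exists K|left; exact: QO].
    move=> /existsNP[C /not_implyP[FC nCx]].
    by exists (W `|` ~` C); [exists C|right].
  - exists C => // x Cx; have [_ _ CK _] := FC.
    by case: (KC x (CK _ Cx)).
(* For [W], [W'] separating [P] from [P'], a member [C] of [F] inside their union has [C]
   intersected with [W] again in [F]; hence [Q] lies in [W] and [P'] is empty. *)
have Qpart P P' : closed P -> closed P' -> Q = P `|` P' -> P `&` P' = set0 ->
    P 1 -> P' = set0.
  move=> clP clP' QPP' PP'0 P1.
  have cP : compact P.
    by apply: subclosed_compact clP cK _ => x Px; apply: QK; rewrite QPP'; left.
  have [W [W' [oO oO' PW P'W' OO'0]]] := compact_disjoint_nbhs cP clP' PP'0.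
  have [|x|C [C1 clC CK clKC] COO'] := key (W `|` W'); first exact: openU.
    by rewrite QPP' => -[/PW|/P'W']; [left|right].
  have FCO : F (C `&` W).
    split; first by split=> //; exact: PW.
    - rewrite (_ : _ `&` _ = C `&` ~` W').
        by apply: closedI => //; exact: open_closedC.
      apply/seteqP; split=> x [Cx Ox]; split=> //.
        by move=> W'x; have : (W `&` W') x by []; rewrite OO'0.
      by case: (COO' _ Cx).
    - by move=> x [/CK].
    - rewrite (_ : _ `\` _ = (K `\` C) `|` (C `&` ~` W)).
        by apply: closedU => //; apply: closedI => //; exact: open_closedC.
      apply/seteqP; split=> x.
        move=> [Kx nCO]; have [Cx|] := pselect (C x); last by left.
        by right; split=> // Ox; exact: nCO.
      by move=> [[Kx nCx]|[Cx nOx]]; split=> //; [case|exact: CK|case].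
  rewrite -subset0 => x P'x; rewrite -OO'0; split; last exact: P'W'.
  have : Q x by rewrite QPP'; right.
  by move=> /(_ _ FCO)[].
have cQ : connected Q.
  move=> B [b Bb] [W oO BO] [Z clZ BZ].
  have clB : closed B by rewrite BZ; exact: closedI.
  have clB' : closed (Q `&` ~` W) by apply: closedI => //; exact: open_closedC.
  have QB : Q = B `|` (Q `&` ~` W) by rewrite BO -setIUr setUv setIT.
  have BB'0 : B `&` (Q `&` ~` W) = set0.
    by rewrite BO setIACA setICr setI0.
  have [B1|nB1] := pselect (B 1).
    by rewrite QB (Qpart _ _ clB clB' QB BB'0 B1) setU0.
  have B0 : B = set0.
    apply: (Qpart _ _ clB' clB); [by rewrite setUC|by rewrite setIC|].
    by split=> // O1; apply: nB1; rewrite BO.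
  by rewrite B0 in Bb.
have Q_eq1 x : Q x -> x = 1.
  move=> Qx; have : connected_component [set: G] 1 x by exists Q.
  by rewrite tdG.
have [|x /Q_eq1 ->|C [C1 clC CK clKC] CintK] := key K^°.
- exact: open_interior.
- by [].
exists C; split=> //; first exact: subclosed_compact clC cK CK.
rewrite (_ : C = K^° `&` ~` (K `\` C)).
  by apply: openI; [exact: open_interior|exact: closed_openC].
apply/seteqP; split=> x; first by move=> Cx; split; [exact: CintK|case].
move=> [/interior_subset Kx nKC]; have [//|nCx] := pselect (C x).
by case: nKC.
Qed.

Lemma compact_open_subgroup : hausdorff_space G -> locally_compact [set: G] ->
  totally_disconnected [set: G] ->
  exists2 U : set G, compact U & open_subgroup U.
Proof.
move=> hG lcG tdG; have [C [cC oC C1]] := compact_open_nbhs1 hG lcG tdG.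
have [U oU UC] := compact_open_nbhs_subgroup cC oC C1; exists U => //.
exact: subclosed_compact (open_subgroup_closed oU) cC UC.
Qed.

End VanDantzig.

(** * Reduced envelopes of compactly generated subgroups *)

Section ReducedEnvelopes.
Local Open Scope group_scope.
Context {G : topologicalGroupType}.
Implicit Types (D E H K N R S U V W X : set G) (g h x y : G).

Lemma reduced_envelopeP H E : subgroup H -> open_subgroup E -> H `<=` E ->
  (forall E2, open_subgroup E2 ->
     covered_by_cosets H E2 -> covered_by_cosets E E2) ->
  reduced_envelope H E.
Proof.
move=> sH oE HE envE; split=> // E2 oE2.
move/(finite_indexP sH oE2.1)/(envE _ oE2) => ?.
exact/(finite_indexP oE.1 oE2.1).
Qed.

Lemma reduced_envelope_covered H E E2 : subgroup H -> reduced_envelope H E ->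
  open_subgroup E2 -> covered_by_cosets H E2 -> covered_by_cosets E E2.
Proof.
move=> sH [oE HE envE] oE2 /(finite_indexP sH oE2.1)/(envE _ oE2).
by move/(finite_indexP oE.1 oE2.1).
Qed.

Lemma commensurateP E E' : subgroup E -> subgroup E' ->
  commensurate E E' <-> covered_by_cosets E E' /\ covered_by_cosets E' E.
Proof.
move=> sE sE'; rewrite /commensurate finite_indexP//.
by rewrite (setIC E) finite_indexP.
Qed.

(** Any two reduced envelopes contain [H], so each is covered by finitely many cosets of the other,
    and one of them determines the class. *)
Lemma envelope_class_reduced H E : subgroup H -> reduced_envelope H E ->
  envelope_class H = [set E' | open_subgroup E' /\ commensurate E' E].
Proof.
move=> sH rE; apply/seteqP; split=> E' [oE' cE'E]; split=> //; last by exists E.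
have [E0 rE0 /commensurateP cE'E0] := cE'E.
have [oE HE _] := rE; have [oE0 HE0 _] := rE0.
have [//||? ?] := cE'E0; first exact: oE'.1.
  exact: oE0.1.
apply/commensurateP; [exact: oE'.1|exact: oE.1|].
have cE0E := reduced_envelope_covered sH rE0 oE (sub_covered HE).
have cEE0 := reduced_envelope_covered sH rE oE0 (sub_covered HE0).
by split; apply: covered_trans; eassumption.
Qed.

Lemma common_envelope_equivalent H1 H2 E : subgroup H1 -> subgroup H2 ->
  reduced_envelope H1 E -> reduced_envelope H2 E -> envelope_equivalent H1 H2.
Proof.
move=> sH1 sH2 rE1 rE2; split; [by exists E|by exists E|].
by rewrite (envelope_class_reduced sH1 rE1) (envelope_class_reduced sH2 rE2).
Qed.

End ReducedEnvelopes.

(** * The residual [R] of a compactly generated subgroup and the existence of envelopes *)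

Section Existence.
Local Open Scope group_scope.
Context {G : topologicalGroupType}.
Implicit Types (D E H K N R S U V W X : set G) (g h x y : G).

Definition normalizedby H N := forall h x, H h -> N x -> N (x ^ h).

Lemma mulset_subgroup N H : subgroup N -> subgroup H -> normalizedby H N ->
  subgroup (mulset N H).
Proof.
move=> sN sH nNH; apply/subgroupP; split.
- by exists 1; [exact: subgroup1|exists 1; [exact: subgroup1|rewrite mulg1]].
- move=> _ _ [n Nn [h Hh <-]] [m Nm [k Hk <-]].
  exists (n * m ^ h^-1).
    by apply: subgroupM => //; apply: nNH => //; exact: subgroupV.
  exists (h * k); first exact: subgroupM.
  by rewrite conjgE invgK !mulgA mulgVK.
- move=> _ [n Nn [h Hh <-]].
  exists ((n ^ h)^-1); first by apply: subgroupV => //; exact: nNH.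
  exists h^-1; first exact: subgroupV.
  by rewrite -conjVg conjgE invgM !mulgA mulgK.
Qed.

Lemma covered_mulset_r S K : subgroup K ->
  covered_by_cosets S K -> covered_by_cosets (mulset S K) K.
Proof.
move=> sK [D fD SD]; exists D => //.
apply: subset_trans (mulset_mono SD (@subset_refl _ K)) _.
by rewrite -mulsetA; apply: mulset_mono => //; exact: mulset_id.
Qed.

(* The conjugates of [E2] by [H] are finite in number, so that their          *)
(* intersection is open.                                                      *)
Lemma open_core H E2 :
  subgroup H -> open_subgroup E2 -> covered_by_cosets H E2 ->
  exists N, [/\ open_subgroup N, normalizedby H N & N `<=` E2].
Proof.
move=> sH [sE2 oE2] [D fD HD].
exists [set g | forall h, H h -> E2 (g ^ h)]; split; last first.
- by move=> g /(_ 1 (subgroup1 sH)); rewrite conjg1.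
- by move=> h g Hh Ng k Hk; rewrite -conjgM; apply: Ng; exact: subgroupM.
have [V [oV V1 VD]] :=
  compact_conj_nbhs (finite_compact fD) oE2 (subgroup1 sE2).
apply: (@open_subgroup_superset _ _ V) => //.
  apply/subgroupP; split=> [h _|x y Nx Ny h Hh|x Nx h Hh].
  - by rewrite conj1g; exact: subgroup1.
  - by rewrite conjMg; apply: subgroupM => //; [exact: Nx|exact: Ny].
  - by rewrite conjVg; apply: subgroupV => //; exact: Nx.
move=> v Vv h /HD[d Dd [e E2e <-]]; rewrite conjgM conjgE.
apply: subgroupM => //; first exact: subgroupV.
by apply: subgroupM => //; exact: VD.
Qed.

(** Conjugation by the compact set [X] and its inverses moves a small [V] inside [U]. Once [W] lies
    in [V R], conjugating [W R] by a generator only moves the [V] part, which stays in [W]. *)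
Lemma cocompact_residual X H U : compact X -> H = generated_subgroup X ->
    compact U -> open_subgroup U ->
  let R := \bigcap_(N in [set N | open_subgroup N /\ normalizedby H N]) N in
  exists W, [/\ compact W, open W, W 1, subgroup (mulset W R)
    & normalizedby H (mulset W R)].
Proof.
move=> cX HX cU oU R.
set F := [set N | open_subgroup N /\ normalizedby H N] in R *.
have sH : subgroup H by rewrite HX; exact: generated_subgroup_closed.
have sR : subgroup R by apply: subgroup_bigcap => N [[]].
have HR : normalizedby H R.
  by move=> h x Hh Rx N FN; apply: FN.2 => //; exact: Rx.
have FT : F setT.
  by split=> //; split; [exact/subgroupP|exact: openT].
have FI N N' : F N -> F N' -> F (N `&` N').
  move=> [[sN oN] HN] [[sN' oN'] HN']; split.
    by split; [exact: subgroupI|exact: openI].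
  by move=> h x Hh [Nx N'x]; split; [exact: HN|exact: HN'].
pose Y := X `|` [set x^-1 | x in X].
have cY : compact Y by apply: compactU => //; exact: compact_invset.
have HY : Y `<=` H.
  rewrite HX => y [|[x Xx <-]]; first exact: sub_generated.
  by apply: (subgroupV (generated_subgroup_closed X)); exact: sub_generated.
have [V [oV V1 VU]] := compact_conj_nbhs cY oU.2 (subgroup1 oU.1).
(* Points of [U] in [R] lie in [V (R & U)], and every other point is excluded by some [N]; since [F]
   is closed under intersection, one [N] excludes all that is left. *)
have [N FN NU] : exists2 N, F N & N `&` U `<=` mulset V (R `&` U).
  have [| | | |_ [N FN <-] UN] :=
    @compact_directed_cover _ U [set mulset V (R `&` U) `|` ~` N | N in F] cU.
  - by exists (mulset V (R `&` U) `|` ~` setT), setT.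
  - move=> _ [N [oN _] <-]; apply: openU; first exact: mulset_open_l.
    by apply: closed_openC; exact: open_subgroup_closed.
  - move=> _ _ [N FN <-] [N' FN' <-].
    exists (mulset V (R `&` U) `|` ~` (N `&` N')).
      by exists (N `&` N') => //; exact: FI.
    by move=> x [[?|nN]|[?|nN]]; [left|right => -[]|left|right => -[]].
  - move=> u Uu; have [Ru|] := pselect (R u).
      exists (mulset V (R `&` U) `|` ~` setT); first by exists setT.
      by left; exists 1 => //; exists u; rewrite ?mul1g.
    move=> /existsNP[N /not_implyP[FN nNu]].
    by exists (mulset V (R `&` U) `|` ~` N); [exists N|right].
  - by exists N => // x [Nx Ux]; case: (UN x Ux).
have [[sN oN] HN] := FN.
have RN : R `<=` N by exact: bigcap_inf.
pose W := N `&` U; pose D := mulset W R.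
have sW : subgroup W by apply: subgroupI => //; exact: oU.1.
have WD : W `<=` D.
  by move=> w Ww; exists w => //; exists 1; rewrite ?mulg1//; exact: subgroup1.
have D1 : D 1 by apply: WD; exact: subgroup1.
have DY d y : Y y -> D d -> D (d ^ y).
  move=> Yy [w /[dup] Ww /NU[v Vv [r [Rr Ur] vrw]] [r' Rr' <-]].
  rewrite -vrw -mulgA conjMg; exists (v ^ y); last first.
    exists ((r * r') ^ y) => //.
    by apply: HR; [exact: HY|exact: (subgroupM sR)].
  split; last exact: VU.
  apply: HN; first exact: HY.
  have -> : v = w * r^-1 by rewrite -vrw mulgK.
  by apply: subgroupM => //; [exact: Ww.1|apply: subgroupV => //; exact: RN].
have HD : normalizedby H D.
  move=> h d Hh Dd.
  have : generated_subgroup X `<=`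
      [set g | forall d, D d -> D (d ^ g) /\ D (d ^ g^-1)].
    apply: generated_sub; first exact: conj_stabilizer_subgroup.
    by move=> x Xx e De; split; apply: DY => //; [left|right; exists x].
  by rewrite -HX => /(_ _ Hh _ Dd)[].
(* [D] is its own left stabilizer, which is why it is a subgroup *)
pose S := [set g | forall d, D d -> D (g * d) /\ D (g^-1 * d)].
have sS : subgroup S by exact: left_stabilizer_subgroup.
have WS : W `<=` S.
  move=> w Ww _ [v Wv [r Rr <-]]; rewrite !mulgA; split.
    by exists (w * v); [exact: subgroupM|exists r].
  by exists (w^-1 * v); [apply: subgroupM => //; exact: subgroupV|exists r].
have FS : F S.
  split.
    apply: (@open_subgroup_superset _ _ W) => //; last exact: subgroup1.
    by apply: openI => //; exact: oU.2.
  move=> h g Hh Sg d Dd.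
  have {}Dd : D (d ^ h^-1) by apply: HD => //; exact: subgroupV.
  have gdE k : k ^ h * d = (k * d ^ h^-1) ^ h by rewrite conjMg conjgKV.
  rewrite -conjVg !gdE; have [? ?] := Sg _ Dd.
  by split; exact: HD.
have DS : D = S.
  apply/seteqP; split=> [_ [w Ww [r Rr <-]]|g /(_ _ D1)[]]; last first.
    by rewrite mulg1.
  by apply: (subgroupM sS); [exact: WS|exact: Rr].
exists W; split=> //.
- apply: subclosed_compact cU _; last by move=> x [].
  by apply: open_subgroup_closed; split=> //; apply: openI => //; exact: oU.2.
- by apply: openI => //; exact: oU.2.
- exact: subgroup1.
- by rewrite -/D DS.
Qed.

Lemma exists_reduced_envelope U H : compact U -> open_subgroup U ->
  compactly_generated H ->
  exists2 E, reduced_envelope H E & compactly_generated E.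
Proof.
move=> cU oU [X cX HX].
have sH : subgroup H by rewrite HX; exact: generated_subgroup_closed.
have [W [cW oW W1 sD HD]] := cocompact_residual cX HX cU oU.
set R := \bigcap_(N in _) N in sD HD.
have R1 : R 1 by move=> N [[sN _] _]; exact: subgroup1.
exists (generated_subgroup (X `|` W)); last first.
  by exists (X `|` W) => //; exact: compactU.
set E := generated_subgroup _.
have sE : subgroup E by exact: generated_subgroup_closed.
(* [H] normalizes both [W R] and [R]: the former makes [W R H] a subgroup containing the generators
   of [E], the latter turns [R H] into [H R]. *)
have EWHR : E `<=` mulset W (mulset H R).
  apply: (@subset_trans _ (mulset (mulset W R) H)).
    apply: generated_sub; first exact: mulset_subgroup.
    rewrite subUset; split=> x.
      move=> Xx; exists 1; first exact: subgroup1.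
      by exists x; rewrite ?mul1g// HX; exact: sub_generated.
    move=> Wx; exists x; last by exists 1; rewrite ?mulg1//; exact: subgroup1.
    by exists x => //; exists 1; rewrite ?mulg1.
  rewrite -mulsetA; apply: mulset_mono => // _ [r Rr [h Hh <-]].
  exists h => //; exists (r ^ h); last by rewrite -conjgC.
  by move=> N FN; apply: FN.2 => //; exact: Rr.
apply: reduced_envelopeP => //.
- apply: (@open_subgroup_superset _ _ W) => // w Ww.
  by apply: sub_generated; right.
- by rewrite HX; apply: generated_mono => x; left.
move=> E2 oE2 cHE2.
have [N [oN HN NE2]] := open_core sH oE2 cHE2.
have RE2 : R `<=` E2 by apply: subset_trans NE2; exact: bigcap_inf.
apply: covered_sub EWHR _; apply: covered_mulset_compact => //.
apply: covered_sub (covered_mulset_r oE2.1 cHE2); exact: mulset_mono.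
Qed.
End Existence.

(** * Dense subgroups of cocompact subgroups *)

Section Cocompact.
Local Open Scope group_scope.
Context {G : topologicalGroupType}.
Implicit Types (A B D E F H K S U V W X : set G) (g h x y : G).

Lemma coset_space_pi_eq B x y :
  \pi_(coset_space B)%qT x = \pi_(coset_space B)%qT y <->
  left_coset x B = left_coset y B.
Proof.
split=> [/(eqmodP (same_left_coset_equivRel B))/asboolP//|xy].
by apply/(eqmodP (same_left_coset_equivRel B))/asboolP.
Qed.

Lemma left_coset_mull B x y g :
  left_coset x B = left_coset y B ->
  left_coset (g * x) B = left_coset (g * y) B.
Proof.
have gE z : left_coset (g * z) B = [set g * t | t in left_coset z B].
  apply/seteqP; split=> [_ [b Bb <-]|_ [_ [b Bb <-] <-]].
    by exists (z * b); [exists b|rewrite mulgA].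
  by exists b; rewrite // mulgA.
by move=> xy; rewrite !gE xy.
Qed.

Lemma left_coset_eq_mem B x y : B 1 ->
  left_coset x B = left_coset y B -> B (x^-1 * y).
Proof.
move=> B1 xy; have : left_coset y B y by exists 1; rewrite ?mulg1.
by rewrite -xy => -[b Bb <-]; rewrite mulKg.
Qed.

(** The saturation of [S] is the product of [S] with the stabilizer of the coset of 1, hence a union
    of right translates of [S]. *)
Lemma coset_space_pi_open B S : open S -> open (\pi_(coset_space B)%qT @` S).
Proof.
move=> oS; rewrite /open /= /quotient_open.
rewrite (_ : _ @^-1` _ = mulset S [set g | left_coset g B = left_coset 1 B]).
  exact: mulset_open_l.
apply/seteqP; split=> [x [s Ss /coset_space_pi_eq sx]|_ [s Ss [g gB <-]]].
  exists s => //; exists (s^-1 * x); last by rewrite mulVKg.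
  by rewrite /= -(left_coset_mull s^-1 sx) mulVg.
exists s => //; apply/coset_space_pi_eq.
by rewrite -{1}(mulg1 s); exact/esym/left_coset_mull.
Qed.

Lemma cocompact_cover B E V : cocompact B -> B 1 -> subgroup E ->
  open_subgroup V -> V `<=` E ->
  exists F, [/\ finite_set F, F `<=` E & E `<=` mulset (mulset V F) (B `&` E)].
Proof.
move=> cB B1 sE [sV oV] VE.
pose q : G -> coset_space B := \pi_(coset_space B)%qT.
have [| | | |_ [D fD <-] qD] := @compact_directed_cover _ [set: coset_space B]
    [set q @` mulset V D | D in finite_set] cB.
- by exists (q @` mulset V set0), set0 => //; exact: finite_set0.
- by move=> _ [D _ <-]; apply: coset_space_pi_open; exact: mulset_open_l.
- move=> _ _ [D fD <-] [D' fD' <-]; exists (q @` mulset V (D `|` D')).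
    by exists (D `|` D') => //; rewrite /= finite_setU.
  by rewrite subUset; split; apply: image_subset; exact: mulset_mono.
- move=> u _; exists (q @` mulset V [set repr u]).
    by exists [set repr u] => //; exact: finite_set1.
  exists (repr u); last exact: reprK.
  by exists 1; [exact: subgroup1|exists (repr u); rewrite ?mul1g].
(* Only the [d] for which [V d B] meets [E] matter; each is traded for an element of [E] with the
   same orbit under [V] in the coset space. *)
pose P d e := E e /\ exists2 v, V v & left_coset (v * d) B = left_coset e B.
exists (((fun d => xget 1 (P d)) @` D) `&` E); split.
- by apply: finite_setIl; exact: finite_image.
- by move=> x [].
move=> e Ee; have [_ [v Vv [d Dd <-]] /coset_space_pi_eq vde] := qD (q e) I.
have /(xgetPex 1) : exists e, P d e by exists e; split=> //; exists v.
set e0 := xget _ _ => -[Ee0 [v0 Vv0 v0de0]].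
have Vvv0 : V (v * v0^-1) by apply: subgroupM => //; exact: subgroupV.
exists (v * v0^-1 * e0).
  by exists (v * v0^-1) => //; exists e0 => //; split=> //; exists d.
exists ((v * v0^-1 * e0)^-1 * e); last by rewrite mulVKg.
split; last first.
  apply: (subgroupM sE) => //; apply: (subgroupV sE).
  by apply: (subgroupM sE) => //; exact: VE.
apply: left_coset_eq_mem => //.
by rewrite -vde -(left_coset_mull (v * v0^-1) v0de0) mulgA mulgVK.
Qed.

Lemma dense_open A W x : closure A x -> open W -> W x -> exists2 a, A a & W a.
Proof.
move=> Ax oW Wx; have [|a [Aa Wa]] := Ax W; last by exists a.
exact: open_nbhs_nbhs.
Qed.

(* As [V F] is open, the finitely many elements of the closure of [A]         *)
(* produced by the Schwarz-Milnor argument can be moved into [A].             *)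
Lemma finitely_generated_in_dense A E U :
  compact U -> open_subgroup U -> subgroup A -> cocompact (closure A) ->
  open_subgroup E -> compactly_generated E ->
  exists S K, [/\ finite_set S, S `<=` A `&` E, compact K
    & E `<=` mulset K (generated_subgroup S)].
Proof.
move=> cU oU sA cA [sE oE] [X cX EX].
pose V := U `&` E.
have oV : open_subgroup V.
  by split; [exact: subgroupI oU.1 sE|exact: openI oU.2 oE].
have [sV opV] := oV.
have cV : compact V.
  by apply: subclosed_compact cU _; [exact: open_subgroup_closed|move=> x []].
have VE : V `<=` E by move=> x [].
have A1 : closure A 1 by apply: subset_closure; exact: subgroup1.
have [F [fF FE EVF]] := cocompact_cover cA A1 sE oV VE.
pose K := mulset V (F `|` [set 1]).
have cK : compact K.
  by apply: compact_mulset => //; apply: finite_compact; rewrite finite_setU.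
have K1 : K 1 by exists 1; [exact: subgroup1|exists 1; [right|rewrite mulg1]].
have oK : open K by exact: mulset_open_l.
have KE : K `<=` E.
  apply: subset_trans (mulset_id sE); apply: mulset_mono => // x [/FE//|->].
  exact: subgroup1.
pose Y := X `|` [set x^-1 | x in X].
have YE : Y `<=` E.
  rewrite EX => y [|[x Xx <-]]; first exact: sub_generated.
  by apply: (subgroupV (generated_subgroup_closed X)); exact: sub_generated.
have cYK : compact (mulset Y K).
  by apply: compact_mulset => //; apply: compactU => //; exact: compact_invset.
pose fin := [set S | finite_set S /\ S `<=` A `&` E].
have [| | | |_ [S [fS SAE] <-] YKS] :=
  @compact_directed_cover _ _ [set mulset K S | S in fin] cYK.
- by exists (mulset K set0), set0.
- by move=> _ [S _ <-]; exact: mulset_open_l.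
- move=> _ _ [S [fS SAE] <-] [S' [fS' S'AE] <-]; exists (mulset K (S `|` S')).
    by exists (S `|` S') => //; split; rewrite ?finite_setU ?subUset.
  by rewrite subUset; split; exact: mulset_mono.
- move=> e YKe; have Ee : E e.
    by apply: (mulset_id sE); apply: mulset_mono YKe.
  (* Write [e = v f b] and choose [a] in [A] so close to [b] that [f a b^-1 f^-1] lies in [V]. Then
     [e] is in [V f a], the error being absorbed into [V]. *)
  have [_ [v Vv [f Ff <-]] [b [Ab Eb] vfb]] := EVF _ Ee.
  have [||a Aa [Ea Va]] :=
    @dense_open A (E `&` (fun x => f * (x * b^-1) * f^-1) @^-1` V) b Ab.
  + apply: openI => //; apply: open_preimage => //.
    apply: continuous_mulg2 => [|x]; last exact: cvg_cst.
    by apply: continuous_mulg2 => [x|]; [exact: cvg_cst|exact: continuous_rmul].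
  + by split=> //=; rewrite mulgV mulg1 mulgV; exact: subgroup1.
  exists (mulset K [set a]).
    by exists [set a] => //; split; [exact: finite_set1|move=> _ ->].
  exists (v * (f * (a * b^-1) * f^-1)^-1 * f); last first.
    by exists a => //; rewrite -vfb !invgM !invgK !mulgA !mulgVK.
  exists (v * (f * (a * b^-1) * f^-1)^-1); last by exists f => //; left.
  by apply: subgroupM => //; exact: subgroupV.
exists S, K; split=> //.
set H := generated_subgroup S.
have sH : subgroup H := @generated_subgroup_closed _ S.
(* From [Y K] inside [K S], the set [K H] is stable under the generators of [E]; it contains 1, so
   it contains [E]. *)
have YKH y k : Y y -> mulset K H k -> mulset K H (y * k).
  move=> Yy [z Kz [h Hh <-]]; have [|z' Kz' [s Ss zs]] := YKS (y * z).
    by exists y => //; exists z.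
  exists z' => //; exists (s * h); last by rewrite mulgA zs mulgA.
  by apply: (subgroupM sH) => //; exact: sub_generated.
have : E `<=` [set g | forall k, mulset K H k ->
    mulset K H (g * k) /\ mulset K H (g^-1 * k)].
  rewrite EX; apply: generated_sub; first exact: left_stabilizer_subgroup.
  by move=> x Xx k Kk; split; apply: YKH => //; [left|right; exists x].
move=> EK e /EK/(_ 1)[]; last by rewrite mulg1.
by exists 1 => //; exists 1; rewrite ?mulg1//; exact: subgroup1.
Qed.

Lemma cocompact_reduced_envelope A H1 E U : compact U -> open_subgroup U ->
  subgroup A -> cocompact (closure A) -> reduced_envelope H1 E ->
  compactly_generated E ->
  exists H2, [/\ subgroup H2, H2 `<=` A, finitely_generated H2
    & reduced_envelope H2 E].
Proof.
move=> cU oU sA cA [oE _ _] cgE.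
have [S [K [fS SAE cK EK]]] := finitely_generated_in_dense cU oU sA cA oE cgE.
have sH := @generated_subgroup_closed _ S.
have HAE : generated_subgroup S `<=` A `&` E.
  by apply: generated_sub => //; exact: subgroupI sA oE.1.
exists (generated_subgroup S); split=> //; last 2 first.
- by exists S.
- apply: reduced_envelopeP => //; first by move=> x /HAE[].
  move=> E2 oE2 cHE2; apply: covered_sub EK _.
  exact: covered_mulset_compact.
- by move=> x /HAE[].
Qed.
End Cocompact.

(** * Finite covolume *)

Section FiniteCovolume.
Import Order.TTheory GRing.Theory Num.Theory.
Local Open Scope ring_scope.
Local Open Scope group_scope.

(** The indicator functions sum to at most [n] at every point; integrate. *)
Lemma sum_measure_multiplicity d (T : measurableType d) (R : realType)
    (mu : {measure set T -> \bar R}%R) (I : Type) (s : seq I)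
    (F : I -> set T) n :
  (forall i, measurable (F i)) ->
  (forall x, count (fun i => x \in F i) s <= n)%N ->
  (\sum_(i <- s) mu (F i) <= n%:R%:E * mu setT)%E.
Proof.
move=> mF Fn.
rewrite -(integral_cst mu measurableT n%:R%:E).
rewrite (eq_bigr (fun i => \int[mu]_(x in setT) (\1_(F i) x)%:E)%E); last first.
  by move=> i _; rewrite integral_indic// setIT.
rewrite -ge0_integral_sum//; last first.
  by move=> i; apply/measurable_EFinP; exact: measurable_indic.
apply: ge0_le_integral => //.
- by move=> x _; apply: sume_ge0 => i _; rewrite lee_fin.
- apply: emeasurable_sum => i.
  by apply/measurable_EFinP; exact: measurable_indic.
- move=> x _; rewrite sumEFin lee_fin.
  apply: le_trans (_ : (count (fun i => x \in F i) s)%:R <= _)%R.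
    rewrite -sum1_count natr_sum [leRHS]big_mkcond /=.
    by apply: ler_sum => i _; rewrite indicE; case: (x \in F i).
  by rewrite ler_nat.
Qed.

Context {G : topologicalGroupType}.
Implicit Types (A B D E H S : set G) (g x y : G).

Lemma coset_act_pi B g x :
  coset_act g (\pi_(coset_space B)%qT x) = \pi_(coset_space B)%qT (g * x).
Proof.
apply/coset_space_pi_eq/left_coset_mull/coset_space_pi_eq.
exact: reprK.
Qed.

Lemma separated_seq E H n : subgroup H -> ~ covered_by_cosets E H ->
  exists s : seq G, [/\ size s = n, forall g, g \in s -> E g
    & pairwise (fun x y => ~~ `[< H (x^-1 * y) >]) s].
Proof.
move=> sH ncE; elim: n => [|n [s [sz sE ps]]]; first by exists [::].
have [g [Eg gs]] : exists g, E g /\ forall h, h \in s -> ~ H (g^-1 * h).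
  apply: contrapT => nex; apply: ncE; exists [set` s]; first exact: finite_seq.
  move=> g Eg; apply: contrapT => ngs; apply: nex.
  exists g; split=> // h hs Hgh.
  apply: ngs; exists h => //; exists (h^-1 * g); last by rewrite mulVKg.
  by rewrite -(invgK g) -invgM; exact: subgroupV.
exists (g :: s); split=> /=; first by rewrite sz.
- by move=> h; rewrite inE => /orP[/eqP->//|/sE].
- by rewrite ps andbT; apply/allP => h hs; apply/asboolPn; exact: gs.
Qed.

(** Cosets of [H] are open, so each one meeting the closure of [A] within the open set [E] already
    meets [A] there. *)
Lemma covered_closure A E H : subgroup E -> open E -> open_subgroup H ->
  covered_by_cosets (A `&` E) H -> covered_by_cosets (closure A `&` E) H.
Proof.
move=> sE oE [sH oH] [D fD AD]; exists D => // b [Ab Eb].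
have [||a Aa [Ea [_ -> [h Hh bha]]]] :=
  @dense_open _ A (E `&` mulset [set b] H) b Ab.
- by apply: openI => //; exact: mulset_open_r.
- by split=> //; exists b => //; exists 1; rewrite ?mulg1//; exact: subgroup1.
have [//|d Dd [k Hk dk]] := AD a.
exists d => //; exists (k * h^-1).
  by apply: (subgroupM sH) => //; exact: (subgroupV sH).
by rewrite mulgA dk -bha mulgK.
Qed.

Lemma measurable_coset_space_pi B S : open S ->
  measurable (\pi_(coset_space B)%qT @` S : set (borel (coset_space B))).
Proof. by move=> oS; apply: sub_sigma_algebra; exact: coset_space_pi_open. Qed.

(** * Translates of open sets under an invariant measure on the coset space *)

Section InvariantMeasure.
Context {R : realType} {B : set G}.
Context {mu : {measure set (borel (coset_space B)) -> \bar R}%R}.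
Context (mu_radon : radon mu).
Context (mu_inv : forall (g : G) (Y : set (borel (coset_space B))),
  measurable Y -> mu (coset_act g @` Y) = mu Y).

Let q : G -> borel (coset_space B) := \pi_(coset_space B)%qT.

Lemma measure_translate g S :
  open S -> mu (q @` mulset [set g] S) = mu (q @` S).
Proof.
move=> oS; rewrite -(mu_inv g (measurable_coset_space_pi oS)).
congr (mu _); apply/seteqP.
split=> [_ [_ [_ -> [x Sx <-]] <-]|_ [_ [x Sx <-] <-]].
  by exists (q x); [exists x|exact: coset_act_pi].
exists (g * x); last exact/esym/coset_act_pi.
by exists g => //; exists x.
Qed.

(** If the image of [S] were null, its translates would cover every compact set by finitely many
    null open sets, and inner regularity would make the whole measure zero. *)
Lemma measure_open_gt0 S :
  open S -> S !=set0 -> mu setT != 0%E -> (0 < mu (q @` S))%E.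
Proof.
move=> oS [s Ss] muT; rewrite lt_neqAle measure_ge0 andbT eq_sym.
apply: contra muT => /eqP muS; rewrite eq_le measure_ge0 andbT.
have [_ _ inner] := mu_radon.
rewrite (inner setT openT); apply: ge_ereal_sup => _ [K [cK _] <-].
pose null := [set U : set (coset_space B) | open U /\ mu U = 0%E].
have [| | | |U [oU muU] KU] := @compact_directed_cover _ K null cK.
- by exists set0; split; [exact: open0|exact: measure0].
- by move=> U [].
- move=> U V [oU muU] [oV muV]; exists (U `|` V) => //.
  split; first exact: openU.
  by rewrite measureU0//; apply: sub_sigma_algebra.
- move=> u _; pose g := repr u * s^-1.
  exists (q @` mulset [set g] S); last first.
    exists (repr u); last exact: reprK.
    by exists g => //; exists s; rewrite // mulgVK.
  split; first by apply: coset_space_pi_open; exact: mulset_open_r.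
  by rewrite measure_translate.
(* The bound of [mu K] by [mu U] is read off the supremum for [U], as measurability of [K] has not
   been established. *)
rewrite -muU (inner U oU); apply: le_ereal_sup_tmp; exists (mu K) => //.
by exists K.
Qed.

(** Fix one representative [z] of [u] in [E]. Each translate by [g] containing [u] puts [z^-1 g] in
    [d H] for some [d] in [D], and distinct [g] of a separated sequence need distinct [d]. *)
Lemma translate_multiplicity E H (D s : seq G) u :
  B 1 -> subgroup E -> subgroup H ->
  B `&` E `<=` mulset [set` D] H ->
  (forall g, g \in s -> E g) ->
  pairwise (fun x y => ~~ `[< H (x^-1 * y) >]) s ->
  (count (fun g => u \in q @` mulset [set g] (E `&` H)) s <= size D)%N.
Proof.
move=> B1 sE sH BD sE' ps; rewrite -size_filter.
set t := seq.filter _ s.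
have tE g : g \in t -> E g by rewrite mem_filter => /andP[_ /sE'].
have tu g : g \in t -> exists x, [/\ E x, H x & q (g * x) = u].
  rewrite mem_filter => /andP[+ _]; rewrite inE.
  move=> [_ [_ -> [x [Ex Hx] <-]] <-].
  by exists x.
have pt : pairwise (fun x y => ~~ `[< H (x^-1 * y) >]) t.
  exact: subseq_pairwise (filter_subseq _ _) ps.
have [->//|[g0 g0t]] : t = [::] \/ exists g, g \in t.
  by case: (t) => [|g t']; [left|right; exists g; exact: mem_head].
have [x0 [Ex0 Hx0 g0x0u]] := tu _ g0t.
pose z := g0 * x0.
have Ez : E z by apply: subgroupM => //; exact: tE.
pose P g d := d \in D /\ H (d^-1 * (z^-1 * g)).
have tP g : g \in t -> P g (xget 1 (P g)).
  move=> gt; apply: xgetPex; have [x [Ex Hx gxu]] := tu _ gt.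
  have [|d Dd [h Hh dh]] := BD (z^-1 * (g * x)).
    split; last first.
      apply: subgroupM => //; first exact: subgroupV.
      by apply: subgroupM => //; exact: tE.
    apply: left_coset_eq_mem => //; apply/coset_space_pi_eq.
    exact: etrans g0x0u (esym gxu).
  exists d; split=> //.
  have -> : d^-1 * (z^-1 * g) = h * x^-1.
    by apply: (mulIg x); rewrite mulgVK -!mulgA -dh mulKg.
  by apply: subgroupM => //; exact: subgroupV.
rewrite -(size_map (fun g => xget 1 (P g))); apply: uniq_leq_size; last first.
  by move=> _ /mapP[g /tP[Dg _] ->].
rewrite uniq_pairwise pairwise_map.
apply: (sub_in_pairwise (P := mem t)) pt; last exact/allP.
move=> g g' gt g't /=; apply: contra => /eqP gg'; apply/asboolP.
have [_ Hg] := tP _ gt; have [_ Hg'] := tP _ g't.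
rewrite gg' in Hg.
have -> : g^-1 * g' = ((xget 1 (P g'))^-1 * (z^-1 * g))^-1 *
    ((xget 1 (P g'))^-1 * (z^-1 * g')).
  by rewrite !invgM !invgK -!mulgA !mulVKg.
by apply: subgroupM => //; exact: subgroupV.
Qed.

End InvariantMeasure.

(** Packing: were [E] not covered, arbitrarily many translates of equal positive measure would
    overlap boundedly in a space of finite measure. *)
Lemma finite_covolume_covered (R : realType) (B E H : set G) :
  finite_covolume R B -> B 1 -> open_subgroup E -> open_subgroup H ->
  covered_by_cosets (B `&` E) H -> covered_by_cosets E H.
Proof.
move=> [mu [mu_radon muT0 muToo mu_inv]] B1 [sE oE] [sH oH].
move=> [_ /finite_seqP[D ->] BD].
apply: contrapT => ncE.
pose q : G -> borel (coset_space B) := \pi_(coset_space B)%qT.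
have oEH : open (E `&` H) by exact: openI.
have EH1 : (E `&` H) 1 by split; exact: subgroup1.
have m_gt0 : (0 < mu (q @` (E `&` H)))%E.
  by apply: measure_open_gt0 => //; exists 1.
have m_le : (mu (q @` (E `&` H)) <= mu setT)%E.
  apply: le_measure => //; rewrite inE//. exact: measurable_coset_space_pi.
have mT_fin : mu setT \is a fin_num by rewrite ge0_fin_numE.
have m_fin : mu (q @` (E `&` H)) \is a fin_num.
  by rewrite ge0_fin_numE//; exact: le_lt_trans m_le muToo.
have bound n : (n%:R * fine (mu (q @` (E `&` H))) <=
    (size D)%:R * fine (mu setT))%R.
  have [s [<- sE' ps]] := separated_seq n sH ncE.
  rewrite -lee_fin !EFinM !fineK//.
  apply: le_trans (sum_measure_multiplicity (s := s)
    (F := fun g => q @` mulset [set g] (E `&` H)) mu _ _).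
  - rewrite (eq_bigr (fun=> mu (q @` (E `&` H)))) => [|g _].
      rewrite -(fineK m_fin) sumEFin big_const_seq count_predT iter_addr_0.
      by rewrite -EFinM lee_fin mulr_natl.
    exact: measure_translate.
  - by move=> g; apply: measurable_coset_space_pi; exact: mulset_open_r.
  - by move=> u; exact: translate_multiplicity.
have m_pos : (0 < fine (mu (q @` (E `&` H))))%R by rewrite -lte_fin fineK.
(* An Archimedean choice of the number of translates exceeds the ratio allowed by [bound]. *)
have := bound (Num.bound
  ((size D)%:R * fine (mu setT) / fine (mu (q @` (E `&` H))))).
apply/negP; rewrite -ltNge -ltr_pdivrMr//; apply: archi_boundP.
by rewrite !mulr_ge0// ?invr_ge0 ?ltW// fine_ge0.
Qed.

Lemma finite_covolume_reduced_envelope (R : realType) A H1 E :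
  subgroup A -> finite_covolume R (closure A) -> reduced_envelope H1 E ->
  reduced_envelope (A `&` E) E.
Proof.
move=> sA vA [[sE oE] _ _].
apply: reduced_envelopeP => //; first exact: subgroupI.
move=> E2 oE2 cAE; apply: (finite_covolume_covered vA) => //.
  by apply: subset_closure; exact: subgroup1.
exact: covered_closure.
Qed.

End FiniteCovolume.

Theorem theorem3 (R : realType) (G : topologicalGroupType)
    (G_hausdorff : hausdorff_space G)
    (G_locally_compact : locally_compact [set: G])
    (G_totally_disconnected : totally_disconnected [set: G])
    (A : set G) (A_subgroup : subgroup A)
    (A_large : cocompact (closure A) \/ finite_covolume R (closure A))
    (H1 : set G) (H1_subgroup : subgroup H1)
    (H1_compactly_generated : compactly_generated H1) :
  (exists H2 : set G,
     [/\ subgroup H2, H2 `<=` A & envelope_equivalent H1 H2]) /\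
  (cocompact (closure A) ->
   exists H2 : set G,
     [/\ subgroup H2, H2 `<=` A, finitely_generated H2
       & envelope_equivalent H1 H2]).
Proof.
have [U cU oU] :=
  compact_open_subgroup G_hausdorff G_locally_compact G_totally_disconnected.
have [E rE cgE] := exists_reduced_envelope cU oU H1_compactly_generated.
have cocompact_case : cocompact (closure A) -> exists H2 : set G,
    [/\ subgroup H2, H2 `<=` A, finitely_generated H2
      & envelope_equivalent H1 H2].
  move=> cA; have [H2 [sH2 H2A fgH2 rE2]] :=
    cocompact_reduced_envelope cU oU A_subgroup cA rE cgE.
  by exists H2; split=> //; exact: common_envelope_equivalent rE rE2.
split=> //.
case: A_large => [/cocompact_case[H2 [? ? _ ?]]|vA]; first by exists H2.
have sAE : subgroup (A `&` E) by apply: subgroupI => //; case: rE => -[].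
exists (A `&` E); split=> //.
apply: (common_envelope_equivalent H1_subgroup sAE rE).
exact: finite_covolume_reduced_envelope vA rE.
Qed.
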